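(* Let $B$ be a unital $\mathbb K$-algebra and let $M_a,K_a\in G_B^{\mathrm{inv}}$ be respectively the moment series and the free cumulant series of a $B$-valued random variable $a$, i.e. two series satisfying the following (mutually equivalent) relations: $$IK_a=(IM_a)\circ(I+IM_aI)^{\circ-1},\qquad K_aI=(M_aI)\circ(I+IM_aI)^{\circ-1},$$ $$I+IM_aI=((1+IK_a)^{-1}I)^{\circ-1}=(I(1+K_aI)^{-1})^{\circ-1},$$ $$1+IM_a=S^r((1+IK_a)^{-1}),\qquad 1+M_aI=S^l((1+K_aI)^{-1}).$$ Let $\zeta:=1+I+I^2+\cdots=(1-I)^{-1}$. Then $$M_a=K_a\circledast\zeta .$$
   Context: $\mathbb K$ is a field of characteristic zero. For a unital $\mathbb K$-algebra $B$, $\mathrm{Mult}[[B]]$ is the set of sequences $f=(f_n)_{n\ge0}$ of $\mathbb K$-multilinear maps $f_n:B^{\otimes n}\to B$ (with $B^{\otimes 0}=\mathbb K$, so $f_0$ is identified with an element of $B$). Product: $(f\cdot g)_n(x_1,\dots,x_n)=\sum_{k=0}^n f_k(x_1,\dots,x_k)\,g_{n-k}(x_{k+1},\dots,x_n)$, also written $fg$, with unit $1=(\delta_{n,0}1)_n$. Composition, when $g_0=0$: $(f\circ g)_n(x_1,\dots,x_n)=\sum_{l\ge0}\sum_{k_1+\cdots+k_l=n,\,k_i\ge1}f_l\big(g_{k_1}(x_1,\dots,x_{k_1}),\dots,g_{k_l}(x_{n-k_l+1},\dots,x_n)\big)$, with unit $I=(\delta_{n,1}\mathrm{Id})_n$.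 Composition takes precedence over multiplication: $f\cdot g\circ h\cdot k=f\cdot(g\circ h)\cdot k$. $G_B^{\mathrm{inv}}=\{f: f_0\in B^\times\}$ is a group for $\cdot$, with inverse $f^{-1}$; $G_B^{\mathrm{dif}}=\{f: f_0=0,\ f_1\in \mathrm{GL}(B)\}$ is a group for $\circ$, with inverse $f^{\circ-1}$. For $F,G\in G_B^{\mathrm{inv}}$: $S^l(F):=F^{-1}\circ(IF)^{\circ-1}$, $S^r(F):=F^{-1}\circ(FI)^{\circ-1}$, $F\bullet G:=G\cdot F\circ(G^{-1}IG)$, and the boxed convolution is $F\circledast G:=S^l\big(S^l(F)\bullet S^l(G)\big)$. A $B$-valued probability space $(\mathcal A,\mathbb E)$ is a unital $\mathbb K$-algebra $\mathcal A$ which is a $B$-bimodule with all triple products of elements of $\mathcal A\cup B$ associative, together with a linear map $\mathbb E:\mathcal A\to B$ with $\mathbb E(1)=1$ and $\mathbb E(xay)=x\mathbb E(a)y$ for $x,y\in B$, $a\in\mathcal A$. Elements of $\mathcal A$ are random variables. The moment series of $a$ has $n$-th component $M_a(x_1,\dots,x_n)=\mathbb E(ax_1ax_2a\cdots ax_na)$, and the free cumulant series $K_a$ is defined by $I\cdot K_a=(IM_a)\circ(I+IM_aI)^{\circ-1}$. *)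

(* Defs.v *)
From HB Require Import structures.
From mathcomp Require Import all_boot all_order all_algebra.
From mathcomp Require Import boolp classical_sets.

Set Implicit Arguments.
Unset Strict Implicit.
Unset Printing Implicit Defensive.

Import GRing.Theory.
Local Open Scope ring_scope.

Reserved Notation "f \oM g" (at level 38, left associativity).

Section Mult.
Variables (K : fieldType) (B : algType K).
Implicit Types (s t : seq B) (x y : B).

(* A sequence of maps f_n : B^n -> B, n >= 0, is encoded as one function on
   seq B, the disjoint union of the B^n; f_n is its restriction to the
   sequences of size n, and f_0 is its value at [::]. *)
Definition multilinear (f : seq B -> B) : Prop :=
  forall s t (c : K) x y,
    f (s ++ (c *: x + y) :: t) = c *: f (s ++ x :: t) + f (s ++ y :: t).

Record mult : Type := Mult {
  mult_fun :> seq B -> B;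
  multP : multilinear mult_fun }.

HB.instance Definition _ := gen_eqMixin mult.
HB.instance Definition _ := gen_choiceMixin mult.

Implicit Types f g h F G : mult.

Lemma mult_ext f g : (forall s, f s = g s) -> f = g.
Proof.
case: f g => [f fP] [g gP] /= /funext fg.
by move: gP; rewrite -fg => gP; congr Mult; apply: Prop_irrelevance.
Qed.

Definition zero_fun s : B := 0.
Definition opp_fun f s : B := - f s.
Definition add_fun f g s : B := f s + g s.

Lemma zero_multP : multilinear zero_fun.
Proof. by move=> *; rewrite /zero_fun scaler0 addr0. Qed.

Lemma opp_multP f : multilinear (opp_fun f).
Proof. by move=> *; rewrite /opp_fun multP opprD scalerN. Qed.

Lemma add_multP f g : multilinear (add_fun f g).
Proof. by move=> *; rewrite /add_fun !multP scalerDr addrACA. Qed.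

Definition mult_zero := Mult zero_multP.
Definition mult_opp f := Mult (opp_multP f).
Definition mult_add f g := Mult (add_multP f g).

Lemma mult_addA : associative mult_add.
Proof. by move=> f g h; apply: mult_ext => s; apply: addrA. Qed.
Lemma mult_addC : commutative mult_add.
Proof. by move=> f g; apply: mult_ext => s; apply: addrC. Qed.
Lemma mult_add0 : left_id mult_zero mult_add.
Proof. by move=> f; apply: mult_ext => s; apply: add0r. Qed.
Lemma mult_addN : left_inverse mult_zero mult_opp mult_add.
Proof. by move=> f; apply: mult_ext => s; apply: addNr. Qed.

HB.instance Definition _ := GRing.isZmodule.Build mult
  mult_addA mult_addC mult_add0 mult_addN.

Definition one_fun s : B := if s is [::] then 1 else 0.

Definition mul_fun (f g : seq B -> B) s : B :=
  \sum_(k < (size s).+1) f (take k s) * g (drop k s).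

Lemma one_multP : multilinear one_fun.
Proof. by move=> [|z s] t c x y; rewrite /= scaler0 addr0. Qed.

Lemma mul_multP f g : multilinear (mul_fun f g).
Proof.
move=> s t c x y; rewrite /mul_fun !size_cat /= scaler_sumr -big_split /=.
apply: eq_bigr => k _; rewrite !take_cat !drop_cat.
case: ltnP => [_|les]; first by rewrite multP mulrDr scalerAr.
case: (k - size s)%N => [|j] /=; first by rewrite !cats0 (multP g [::]) mulrDr scalerAr.
by rewrite multP mulrDl scalerAl.
Qed.

Definition mult_one := Mult one_multP.
Definition mult_mul f g := Mult (mul_multP f g).

Lemma mul_fun_nil (f g : seq B -> B) : mul_fun f g [::] = f [::] * g [::].
Proof. by rewrite /mul_fun big_ord1. Qed.

Lemma mul_fun_cons (f g : seq B -> B) x s :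
  mul_fun f g (x :: s) = f [::] * g (x :: s) + mul_fun (f \o cons x) g s.
Proof. by rewrite /mul_fun big_ord_recl /=. Qed.

Lemma mul_funA (f g h : seq B -> B) s :
  mul_fun f (mul_fun g h) s = mul_fun (mul_fun f g) h s.
Proof.
elim: s f g => [|x s IHs] f g; first by rewrite !mul_fun_nil mulrA.
rewrite !mul_fun_cons mul_fun_nil IHs mulrDr mulrA -addrA; congr (_ + _).
rewrite /mul_fun mulr_sumr -big_split /=; apply: eq_bigr => k _.
by rewrite -/(mul_fun f g (x :: take k s)) mul_fun_cons mulrDl mulrA.
Qed.

Lemma mult_mulA : associative mult_mul.
Proof. by move=> f g h; apply: mult_ext => s; apply: mul_funA. Qed.

Lemma mult_mul1r : left_id mult_one mult_mul.
Proof.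
move=> f; apply: mult_ext => s; rewrite /= /mul_fun big_ord_recl take0 drop0.
rewrite mul1r big1 ?addr0 // => i _; case: s i => [|x s] i; first by case: i.
by rewrite /= mul0r.
Qed.

Lemma mult_mulr1 : right_id mult_one mult_mul.
Proof.
move=> f; apply: mult_ext => s; rewrite /= /mul_fun big_ord_recr /=.
rewrite take_size drop_size mulr1 big1 ?add0r // => i _.
by rewrite (drop_nth 0) ?ltn_ord //= mulr0.
Qed.

Lemma mult_mulDl : left_distributive mult_mul +%R.
Proof.
move=> f g h; apply: mult_ext => s; rewrite /= /add_fun /= /mul_fun -big_split.
by apply: eq_bigr => k _; rewrite /= -mulrDl.
Qed.

Lemma mult_mulDr : right_distributive mult_mul +%R.
Proof.
move=> f g h; apply: mult_ext => s; rewrite /= /add_fun /= /mul_fun -big_split.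
by apply: eq_bigr => k _; rewrite /= -mulrDr.
Qed.

Lemma mult_one_neq0 : mult_one != 0.
Proof.
by apply/eqP => /(congr1 (fun f : mult => f [::])) /eqP; rewrite /= oner_eq0.
Qed.

HB.instance Definition _ := GRing.Zmodule_isNzRing.Build mult
  mult_mulA mult_mul1r mult_mulr1 mult_mulDl mult_mulDr mult_one_neq0.

(* mult_unit makes f^-1 the two-sided inverse of f for the product whenever
   there is one, in particular when f is in Ginv below. *)
Definition mult_unit f : bool := `[< exists g, g * f = 1 /\ f * g = 1 >].
Definition mult_inv f : mult :=
  xget f [set g : mult | g * f = 1 /\ f * g = 1]%classic.

Lemma mult_invP f : mult_unit f -> mult_inv f * f = 1 /\ f * mult_inv f = 1.
Proof.
move/asboolP => [g gP].
by have := @xgetPex _ f [set g | g * f = 1 /\ f * g = 1]%classic; apply; exists g.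
Qed.

Lemma mult_mulVr : {in mult_unit, left_inverse 1 mult_inv *%R}.
Proof. by move=> f /mult_invP[]. Qed.
Lemma mult_divrr : {in mult_unit, right_inverse 1 mult_inv *%R}.
Proof. by move=> f /mult_invP[]. Qed.
Lemma mult_unitrP f g : g * f = 1 /\ f * g = 1 -> mult_unit f.
Proof. by move=> fg; apply/asboolP; exists g. Qed.
Lemma mult_invr_out : {in [predC mult_unit], mult_inv =1 id}.
Proof.
move=> f /negP fN; apply: xgetPN => g fg; apply: fN.
by apply/asboolP; exists g.
Qed.

HB.instance Definition _ := GRing.NzRing_hasMulInverse.Build mult
  mult_mulVr mult_divrr mult_unitrP mult_invr_out.

Definition id_fun s : B := if s is [:: x] then x else 0.

Lemma id_multP : multilinear id_fun.
Proof.
move=> [|u [|v s]] [|w t] c x y //=; by rewrite ?scaler0 ?addr0.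
Qed.

Definition mult_id := Mult id_multP.

(* As the k_i are positive with sum n, both l and the k_i are at most n. *)
Definition comp_fun (f g : seq B -> B) s : B :=
  let n := size s in
  \sum_(l < n.+1)
    \sum_(k : l.-tuple 'I_n.+1 | all (fun i : 'I_n.+1 => 0 < i)%N k
                                 && (sumn (map val k) == n))
      f (map g (reshape (map val k) s)).

Lemma reshape_mid (T : Type) (sh : seq nat) (s t : seq T) :
  sumn sh = (size s + (size t).+1)%N ->
  exists ss u v tt, forall x : T,
    reshape sh (s ++ x :: t) = ss ++ (u ++ x :: v) :: tt.
Proof.
elim: sh s => [|n sh IHsh] s /=; first by rewrite addnS.
move=> n_eq; case: (ltnP (size s) n) => [ltsn|lens].
  exists [::], s, (take (n - size s).-1 t), (reshape sh (drop (n - size s).-1 t)).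
  move=> x; rewrite /= take_cat drop_cat ltnNge (ltnW ltsn) /=.
  by move: ltsn; rewrite -subn_gt0; case: (n - size s)%N.
have /IHsh[ss [u [v [tt e]]]] : sumn sh = (size (drop n s) + (size t).+1)%N.
  by apply: (@addnI n); rewrite n_eq size_drop addnA subnKC.
exists (take n s :: ss), u, v, tt => x; rewrite /= -e take_cat drop_cat.
case: (ltngtP n (size s)) lens => // -> _.
by rewrite subnn /= take_size drop_size cats0.
Qed.

Lemma comp_multP f g : multilinear (comp_fun f g).
Proof.
move=> s t c x y; rewrite /comp_fun !size_cat /= scaler_sumr -big_split /=.
apply: eq_bigr => l _; rewrite scaler_sumr -big_split /=.
apply: eq_bigr => k /andP[_ /eqP/reshape_mid[ss [u [v [tt e]]]]].
by rewrite !e !map_cat /= !multP.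
Qed.

Definition mult_comp f g := Mult (comp_multP f g).

Notation "f \oM g" := (mult_comp f g).
Notation I := mult_id.

Definition Ginv f : Prop := exists y, y * f [::] = 1 /\ f [::] * y = 1.

(* f_1 is K-linear by multP, so f_1 \in GL(B) amounts to its bijectivity. *)
Definition Gdif f : Prop := f [::] = 0 /\ bijective (fun x => f [:: x]).

(* The inverse of f in the group Gdif for \oM; the default value f is only
   taken when f is not in Gdif. *)
Definition comp_inv f : mult :=
  xget f [set g : mult | Gdif g /\ g \oM f = I /\ f \oM g = I]%classic.

Definition Sl F : mult := F^-1 \oM comp_inv (I * F).
Definition Sr F : mult := F^-1 \oM comp_inv (F * I).

Definition bullet F G : mult := G * (F \oM (G^-1 * I * G)).

Definition boxconv F G : mult := Sl (bullet (Sl F) (Sl G)).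

Definition zeta : mult := (1 - I)^-1.

End Mult.

Notation "f \oM g" := (mult_comp f g) : ring_scope.
Notation "F \boxconv G" := (boxconv F G) (at level 40, left associativity) : ring_scope.

Arguments mult_id {K B}.
Arguments zeta {K B}.
Notation Id := mult_id.

Section ZetaExpansion.
Variables (K : fieldType) (B : algType K).

Lemma idX (k : nat) (s : seq B) :
  ((Id : mult B) ^+ k) s = if size s == k then \prod_(x <- s) x else 0.
Proof.
elim: k s => [|k IHk] s.
  by case: s => [|x s] //=; rewrite big_nil.
rewrite exprS; case: s => [|x s].
  by rewrite [LHS]mul_fun_nil mul0r.
rewrite [LHS]mul_fun_cons mul0r add0r /mul_fun big_ord_recl /= take0 drop0 /=.
rewrite IHk eqSS [X in _ + X]big1 ?addr0; last first.
  by move=> i _; case: s i => [|y s] i; [case: i | rewrite /= mul0r].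
by rewrite big_cons; case: ifP; rewrite ?mulr0.
Qed.

(* The two descriptions 1 + I + I^2 + ... and (1 - I)^-1 of zeta agree; in
   each arity the series has finitely many nonzero terms. *)
Lemma zetaE (s : seq B) :
  (zeta : mult B) s = \sum_(k < (size s).+1) ((Id : mult B) ^+ k) s.
Proof.
have geomE t : \sum_(k < (size t).+1) ((Id : mult B) ^+ k) t
             = \prod_(x <- t) x.
  rewrite big_ord_recr /= idX eqxx big1 ?add0r // => k _.
  by rewrite idX gtn_eqF.
have prodP : multilinear (fun t : seq B => \prod_(x <- t) x).
  move=> u v c x y; rewrite !big_cat /= !big_cons mulrDl mulrDr.
  by rewrite -scalerAl -scalerAr.
rewrite geomE; pose z := Mult prodP.
have zr : z * (1 - Id) = 1.
  rewrite mulrBr mulr1; apply: mult_ext => t.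
  rewrite -[RHS]/(one_fun t) -[LHS]/(z t - mul_fun z (@id_fun K B) t).
  case/lastP: t => [|t x].
    by rewrite mul_fun_nil /= big_nil mulr0 subr0.
  rewrite /mul_fun size_rcons !big_ord_recr /= -cats1.
  rewrite take_size_cat // drop_size_cat // [drop (size t).+1 _]drop_oversize;
    last by rewrite size_cat addn1.
  rewrite mulr0 addr0 [X in _ - (X + _)]big1 ?add0r; last first.
    move=> i _; rewrite drop_cat ltn_ord cats1.
    have: (0 < size (drop i t))%N by rewrite size_drop subn_gt0.
    by case: (drop i t) => // u [|v w] /= _; rewrite mulr0.
  by rewrite big_cat big_seq1 /= subrr; case: (t).
have zl : (1 - Id) * z = 1.
  rewrite mulrBl mul1r; apply: mult_ext => t.
  rewrite -[RHS]/(one_fun t) -[LHS]/(z t - mul_fun (@id_fun K B) z t).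
  case: t => [|x t]; first by rewrite mul_fun_nil /= big_nil mul0r subr0.
  rewrite mul_fun_cons mul0r add0r /mul_fun big_ord_recl /= take0 drop0 /=.
  rewrite [X in _ - (_ + X)]big1 ?addr0 ?big_cons ?subrr // => i _.
  by case: t i => [|y t] i; [case: i | rewrite /= mul0r].
suff -> : zeta = z by [].
have zu : 1 - Id \is a @GRing.unit (mult B) by apply/unitrP; exists z.
by apply: (mulrI zu); rewrite zl mulrV.
Qed.

End ZetaExpansion.

(* The hypotheses lactA .. mid_assoc are the associativity of the triple
   products of elements of A and B that does not already hold in A or in B. *)
Record bprobSpace (K : fieldType) (B : algType K) : Type := BProbSpace {
  bprob_alg :> algType K;
  lact : B -> bprob_alg -> bprob_alg;
  ract : bprob_alg -> B -> bprob_alg;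
  lact_linearl : forall a c x y, lact (c *: x + y) a = c *: lact x a + lact y a;
  lact_linearr : forall x c a b, lact x (c *: a + b) = c *: lact x a + lact x b;
  ract_linearl : forall x c a b, ract (c *: a + b) x = c *: ract a x + ract b x;
  ract_linearr : forall a c x y, ract a (c *: x + y) = c *: ract a x + ract a y;
  lact1 : forall a, lact 1 a = a;
  ract1 : forall a, ract a 1 = a;
  lactA : forall x y a, lact (x * y) a = lact x (lact y a);
  ractA : forall a x y, ract a (x * y) = ract (ract a x) y;
  lract_assoc : forall x a y, ract (lact x a) y = lact x (ract a y);
  lact_mul : forall x a b, lact x a * b = lact x (a * b);
  ract_mul : forall a b x, ract (a * b) x = a * ract b x;
  mid_assoc : forall a x b, ract a x * b = a * lact x b;
  expect : {linear bprob_alg -> B};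
  expect1 : expect 1 = 1;
  expect_bimod : forall x a y, expect (ract (lact x a) y) = x * expect a * y }.

Section Moments.
Variables (K : fieldType) (B : algType K) (A : bprobSpace B).
Implicit Types (a u v : A) (s t : seq B).

(* word a u [:: x1; ...; xn] = u x1 a x2 a ... a xn a *)
Definition word a u s : A := foldl (fun w x => ract w x * a) u s.

Lemma word_linear a s c u v : word a (c *: u + v) s = c *: word a u s + word a v s.
Proof.
elim: s u v => //= x s IHs u v.
by rewrite ract_linearl mulrDl -scalerAl IHs.
Qed.

Definition moment_fun a s : B := expect A (word a a s).

Lemma moment_multP a : multilinear (moment_fun a).
Proof.
move=> s t c x y; rewrite /moment_fun /word !foldl_cat /=.
by rewrite ract_linearr mulrDl -scalerAl -!/(word _ _ t) word_linear linearP.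
Qed.

Definition moment a : mult B := Mult (moment_multP a).

Definition is_free_cumulant a (C : mult B) : Prop :=
  Id * C
  = (Id * moment a) \oM comp_inv (Id + Id * moment a * Id).

End Moments.

(* Main.v *)
Require Import Defs.
From mathcomp Require Import all_boot all_order all_algebra.
From mathcomp Require Import boolp classical_sets.
Import GRing.Theory.
Set Implicit Arguments.
Unset Strict Implicit.
Unset Printing Implicit Defensive.
Local Open Scope ring_scope.

(** Write W = I + I M I, which is both I (1 + M I) and (1 + I M) I. Composition on
the right with a fixed series is a unital ring morphism for the product
([compD], [comp1], [compM]), so applying it to each of the six relations and
cancelling I on one side reduces every one of them to
<<
   (1 + M I) (C o W) = M     or     (C o W) (1 + I M) = M,
>>
and these two say the same, since (1 + M I) M = M (1 + I M).

For the boxed convolution, S^l(zeta) = (1 + I)^-1, hence the substituted series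
G^-1 I G in the bullet product is I itself, and C boxconv zeta is S^l(N) with
N = (1 + I)^-1 S^l(C). If T is the compositional inverse of I C, then
I S^l(C) = T, so I N = (1 + I)^-1 T. The first relation reads I M = (I C) o W, that
is T o (I M) = W = (1 + I M) I; therefore (I N) o (I M) = I, and I M is the
compositional inverse of I N. Consequently
<<
   S^l(N) = N^-1 o (I M) = (C o T o (I M)) (1 + I M) = (C o W) (1 + I M) = M.
>>

The remaining work is to see that compositional and multiplicative inverses
exist and that composition is associative. The sum over all compositions
of n is awkward for this; [comp_fun_cons] peels off the block that contains
the first variable and turns it into a recursion on n. The key step
is [comp_fun_cut], which describes how composition distributes over any
operation that cuts its arguments into a prefix and a suffix: it gives
multiplicativity directly, and associativity by induction. Inverses are fixed
points of maps that compute arity n from arities below n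
([contraction_fixpoint]). *)

(** * Composition as a recursion on the arity *)

Section CompRec.
Variables (K : fieldType) (B : algType K).
Implicit Types (f g h : seq B -> B) (s t : seq B).

(** The part of f o g in which f receives exactly l arguments. *)
Fixpoint comp_len g l f s : B :=
  match l, s with
  | 0, [::] => f [::]
  | l'.+1, x :: s' =>
    \sum_(k < (size s').+1)
       comp_len g l' (f \o cons (g (x :: take k s'))) (drop k s')
  | _, _ => 0
  end.

Lemma comp_len_gt g l f s : (size s < l)%N -> comp_len g l f s = 0.
Proof.
elim: l f s => [|l IHl] f [|x s] //= lts.
by apply: big1 => k _; rewrite IHl // size_drop (leq_ltn_trans (leq_subr _ _)).
Qed.

(** The bound N is kept free, although only N = size s + 1 occurs in the definition
of the composition: the induction on l shortens s but leaves N unchanged. *)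
Lemma sum_composition g N l f s : (size s < N)%N ->
  \sum_(k : l.-tuple 'I_N | all (fun i : 'I_N => 0 < i)%N k
                            && (sumn (map val k) == size s))
     f (map g (reshape (map val k) s)) = comp_len g l f s.
Proof.
elim: l f s => [|l IHl] f s ltsN.
  case: s ltsN => [|x s] ltsN /=.
    rewrite (bigD1 [tuple]) //= big1 ?addr0 // => k /andP[_ /eqP k0].
    by case: k0; rewrite [k]tuple0.
  by rewrite big_pred0 // => k; rewrite tuple0.
(* A composition with l + 1 blocks is a first block and one with l blocks. *)
pose cns (p : 'I_N * l.-tuple 'I_N) : l.+1.-tuple 'I_N := [tuple of p.1 :: p.2].
rewrite (reindex cns) /=; last first.
  exists (fun k : l.+1.-tuple 'I_N => (thead k, [tuple of behead k])).
    by move=> [i k] _ /=; congr (_, _); apply: val_inj.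
  by move=> k _; rewrite /cns /=; apply: val_inj; rewrite /= [in RHS](tuple_eta k).
case: s ltsN => [|x s] ltsN.
  by rewrite big_pred0 // => -[[[|i] lei] k] //=; rewrite addSn andbF.
rewrite /= in ltsN *.
transitivity (\sum_(i < N | (0 < i <= (size s).+1)%N)
  \sum_(k : l.-tuple 'I_N | all (fun i : 'I_N => 0 < i)%N k
                      && (sumn (map val k) == size (drop i (x :: s))))
     f (map g (take i (x :: s) :: reshape (map val k) (drop i (x :: s))))).
  rewrite pair_big_dep /=; apply: eq_bigl => -[i k] /=.
  rewrite size_drop /= -!andbA; case: ltnP => //= i0.
  case: leqP => [leis|ltsi] /=.
    by congr (_ && _); rewrite -(eqn_add2l i (sumn _)) subnKC.
  by apply/negbTE; rewrite negb_and orbC neq_ltn (leq_trans ltsi) ?leq_addr ?orbT.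
transitivity (\sum_(i < N | (0 < i <= (size s).+1)%N)
    comp_len g l (f \o cons (g (take i (x :: s)))) (drop i (x :: s))).
  apply: eq_bigr => i /andP[i0 leis].
  rewrite -(IHl (f \o cons (g (take i (x :: s))))) // size_drop /=.
  exact: leq_ltn_trans (leq_subr _ _) ltsN.
rewrite -(big_mkord (fun i => 0 < i <= (size s).+1)%N
  (fun i => comp_len g l (f \o cons (g (take i (x :: s)))) (drop i (x :: s)))).
rewrite -(@big_nat_widen _ _ _ 0 (size s).+2 N (leq 1)) //.
by rewrite big_mkord big_mkcond big_ord_recl /= add0r; apply: eq_bigr.
Qed.

Lemma comp_fun_len f g s n : (size s < n)%N ->
  comp_fun f g s = \sum_(l < n) comp_len g l f s.
Proof.
move=> ltsn; transitivity (\sum_(l < (size s).+1) comp_len g l f s).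
  by apply: eq_bigr => l _; apply: sum_composition.
rewrite (big_ord_widen _ (fun l => comp_len g l f s) ltsn) big_mkcond.
by apply: eq_bigr => l _; case: ltnP => // ltsl; rewrite comp_len_gt.
Qed.

Lemma comp_fun_nil f g : comp_fun f g [::] = f [::].
Proof. by rewrite (@comp_fun_len f g [::] 1) // big_ord1. Qed.

Lemma comp_fun_cons f g x s :
  comp_fun f g (x :: s) = \sum_(k < (size s).+1)
    comp_fun (f \o cons (g (x :: take k s))) g (drop k s).
Proof.
rewrite (comp_fun_len _ _ (ltnSn _)) big_ord_recl add0r /= exchange_big.
apply: eq_bigr => k _; apply/esym/comp_fun_len.
by rewrite ltnS size_drop leq_subr.
Qed.

Lemma comp_funD f1 f2 g s :
  comp_fun (fun u => f1 u + f2 u) g s = comp_fun f1 g s + comp_fun f2 g s.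
Proof.
rewrite /comp_fun -big_split; apply: eq_bigr => l _ /=.
by rewrite -big_split.
Qed.

Lemma morphD0 (p : B -> B) : {morph p : x y / x + y} -> p 0 = 0.
Proof. by move=> pD; apply: (@addIr _ (p 0)); rewrite -pD !add0r. Qed.

Lemma comp_fun_additive (p : B -> B) f g s :
  {morph p : x y / x + y} -> comp_fun (p \o f) g s = p (comp_fun f g s).
Proof.
move=> pD; have p0 := morphD0 pD.
rewrite /comp_fun (big_morph p pD p0); apply: eq_bigr => l _.
by rewrite (big_morph p pD p0).
Qed.

(** The index k of the left-hand side is i + j on the right. *)
Lemma sum_triangle n (F : nat -> nat -> B) :
  \sum_(k < n) \sum_(i < k.+1) F i k =
  \sum_(i < n) \sum_(j < n - i) F i (i + j)%N.
Proof.
elim: n => [|n IHn]; first by rewrite !big_ord0.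
rewrite big_ord_recr /= IHn big_ord_recr [in RHS]big_ord_recr /= subSnn.
rewrite big_ord1 addn0 addrA -big_split /=; congr (_ + _).
apply: eq_bigr => i _; rewrite (subSn (ltnW (ltn_ord i))) big_ord_recr /=.
by rewrite subnKC // ltnW.
Qed.

(** Substituting h and then cutting between two blocks is the same as cutting the
variables first and substituting in both pieces. Letting Phi be an
arbitrary function of the two pieces, rather than a product, is what makes the
lemma usable for associativity, where the second piece is again fed to a
composition whose first argument depends on the first piece. *)
Lemma comp_fun_cut (Phi : seq B -> seq B -> B) h s :
  comp_fun (fun t => \sum_(m < (size t).+1) Phi (take m t) (drop m t)) h s =
  \sum_(i < (size s).+1)
     comp_fun (fun u => comp_fun (Phi u) h (drop i s)) h (take i s).
Proof.
have [n] := ubnP (size s); elim: n => // n IHn in Phi s *; rewrite ltnS => lesn.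
case: s lesn => [|x s] lesn.
  by rewrite comp_fun_nil !big_ord1 /= comp_fun_nil comp_fun_nil.
rewrite comp_fun_cons [RHS]big_ord_recl /= comp_fun_nil comp_fun_cons.
under [X in _ = _ + X]eq_bigr => i _.
  rewrite comp_fun_cons size_takel ?leq_ord //; over.
rewrite (sum_triangle _ (fun k i => comp_fun ((fun u => comp_fun (Phi u) h
   (drop i s)) \o cons (h (x :: take k (take i s)))) h (drop k (take i s)))).
rewrite -big_split; apply: eq_bigr => k _ /=.
set z := h _.
have -> : (fun t => \sum_(m < (size t).+1) Phi (take m t) (drop m t)) \o cons z
  = fun t => Phi [::] (z :: t) +
             \sum_(m < (size t).+1) Phi (z :: take m t) (drop m t).
  by apply/funext => t; rewrite /= big_ord_recl.
rewrite comp_funD; congr (_ + _).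
rewrite (IHn (fun u v => Phi (z :: u) v)); last first.
  by rewrite size_drop (leq_ltn_trans (leq_subr _ _)).
rewrite size_drop -subSn ?leq_ord //; apply: eq_bigr => m _.
by rewrite drop_drop take_drop take_takel ?leq_addr // addnC.
Qed.

Lemma multilinear_cons f x :
  multilinear f -> multilinear (f \o cons x).
Proof. by move=> fP s t c y z; rewrite /= -!cat_cons fP. Qed.

(** In both sides the first block of f is g of some blocks of h that
together cover a prefix of s; the left side sums over that prefix, and the
right side over the first block of h and then over the number of variables in the
following ones, which are regrouped by [sum_triangle]. The first
argument of f is then a sum, and linearity of f takes it out. *)
Lemma comp_funA f g h s : multilinear f ->
  comp_fun f (comp_fun g h) s = comp_fun (comp_fun f g) h s.
Proof.
have [n] := ubnP (size s); elim: n => // n IHn in f s *; rewrite ltnS => lesn fP.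
case: s lesn => [|x s] lesn; first by rewrite !comp_fun_nil.
rewrite !comp_fun_cons.
under eq_bigr => k _.
  rewrite IHn; first over; last exact: multilinear_cons.
  by rewrite size_drop (leq_ltn_trans (leq_subr _ _)).
(* The contribution of a prefix of length k + 1, once g o h of it is z. *)
pose Psi k z := comp_fun (comp_fun (f \o cons z) g) h (drop k s).
have PsiD k : {morph Psi k : y z / y + z}.
  move=> y z; rewrite -comp_funD; congr comp_fun; apply/funext => t.
  rewrite -comp_funD; congr comp_fun; apply/funext => u.
  by rewrite /= -{1}[y]scale1r (fP [::]) scale1r.
transitivity (\sum_(k < (size s).+1) \sum_(i < k.+1)
   Psi k (comp_fun (g \o cons (h (x :: take i s))) h (drop i (take k s)))).
  apply: eq_bigr => k _; rewrite -/(Psi k _) comp_fun_cons size_takel ?leq_ord //.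
  rewrite (big_morph (Psi k) (PsiD k) (morphD0 (PsiD k))).
  by apply: eq_bigr => i _; rewrite take_takel ?leq_ord.
rewrite (sum_triangle _ (fun i k =>
   Psi k (comp_fun (g \o cons (h (x :: take i s))) h (drop i (take k s))))).
apply: eq_bigr => i _ /=; set y := h _.
have -> : comp_fun f g \o cons y = fun t => \sum_(m < (size t).+1)
    comp_fun (f \o cons (g (y :: take m t))) g (drop m t).
  by apply/funext => t; rewrite /= comp_fun_cons.
rewrite (comp_fun_cut (fun u => comp_fun (f \o cons (g (y :: u))) g)).
rewrite size_drop -subSn ?leq_ord //; apply: eq_bigr => m _.
rewrite drop_drop take_drop addnC -comp_fun_additive //.
Qed.
End CompRec.

(** * The ring of series under composition *)

Section Series.
Variables (K : fieldType) (B : algType K).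
Implicit Types (f g h F G V W : mult B) (s t : seq B).

Lemma mult_subE f g s : (f - g) s = f s - g s.
Proof. by []. Qed.

Lemma mult_mulE f g s :
  (f * g) s = \sum_(k < (size s).+1) f (take k s) * g (drop k s).
Proof. by []. Qed.

Lemma mult_mul_nil f g : (f * g) [::] = f [::] * g [::].
Proof. exact: Defs.mul_fun_nil. Qed.

Lemma comp_nil f g : (f \oM g) [::] = f [::].
Proof. exact: comp_fun_nil. Qed.

Lemma compA f g h : f \oM (g \oM h) = f \oM g \oM h.
Proof. by apply: mult_ext => s; apply: comp_funA; apply: multP. Qed.

Lemma compD f g h : (f + g) \oM h = f \oM h + g \oM h.
Proof. by apply: mult_ext => s; apply: comp_funD. Qed.

Lemma compN f h : (- f) \oM h = - (f \oM h).
Proof.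
by apply: mult_ext => s; apply: (comp_fun_additive (p := -%R)) => x y; apply: opprD.
Qed.

Lemma compM f g h : (f * g) \oM h = (f \oM h) * (g \oM h).
Proof.
apply: mult_ext => s; rewrite [LHS](comp_fun_cut (fun u v => f u * g v)).
apply: eq_bigr => i _ /=.
rewrite -(comp_fun_additive (p := *%R^~ _)); last by move=> x y; apply: mulrDl.
congr comp_fun; apply/funext => u /=.
by rewrite -(comp_fun_additive (p := *%R _)) // => x y; apply: mulrDr.
Qed.

Lemma comp_fun0 (g : seq B -> B) s : comp_fun (fun=> 0) g s = 0.
Proof.
apply: (comp_fun_additive (p := fun=> 0) (fun=> 0) g s) => x y.
by rewrite addr0.
Qed.

Lemma comp1 h : 1 \oM h = 1.
Proof.
apply: mult_ext => -[|x s]; rewrite /= ?comp_fun_nil // comp_fun_cons.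
by apply: big1 => k _; apply: comp_fun0.
Qed.

Lemma compIl g : g [::] = 0 -> Id \oM g = g.
Proof.
move=> g0; apply: mult_ext => -[|x s]; first by rewrite comp_nil.
rewrite [LHS]comp_fun_cons.
have compE k : comp_fun (id_fun (B:=B) \o cons (g (x :: take k s))) g (drop k s)
    = g (x :: take k s) * (1 : mult B) (drop k s).
  rewrite -[in RHS](comp1 g) -comp_fun_additive; last by move=> y z; apply: mulrDr.
  by congr comp_fun; apply/funext => -[|y t] /=; rewrite ?mulr1 ?mulr0.
rewrite big_ord_recr big1 /= => [|k _]; last first.
  by rewrite compE (drop_nth 0) //= mulr0.
by rewrite add0r compE take_size drop_size /= mulr1.
Qed.

Lemma compIr f : f \oM Id = f.
Proof.
apply: mult_ext => s /=; elim: s (mult_fun f) (multP f) => [|x s IHs] f' fP.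
  by rewrite comp_fun_nil.
rewrite comp_fun_cons big_ord_recl take0 drop0 IHs; last exact: multilinear_cons.
rewrite big1 ?addr0 // => k _.
rewrite -[RHS](comp_fun0 (@id_fun K B) (drop (lift ord0 k) s)); congr comp_fun.
apply/funext => t /=; case: s k {IHs} => [|y s] k /=; first by case: k.
have := fP [::] t 1 0 0; rewrite !scale1r addr0 /= => f0.
by apply: (@addrI _ (f' (0 :: t))); rewrite -f0 addr0.
Qed.

(** * Multiplicative and compositional inverses *)

(** The n-th iterate started at 0 is final on the sequences of size below n, so the
limit can be read off arity by arity. *)
Lemma contraction_fixpoint (Phi : mult B -> mult B) :
  (forall n g h, (forall s, size s < n -> g s = h s)%N ->
                 (forall s, size s <= n -> Phi g s = Phi h s)%N) ->
  exists g, Phi g = g.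
Proof.
move=> PhiP; pose a n := iter n Phi 0.
have aS n s : (size s < n)%N -> a n.+1 s = a n s.
  elim: n s => // n IHn s; rewrite ltnS => les.
  exact: (PhiP n) les.
have aE n s : (size s < n)%N -> a n s = a (size s).+1 s.
  elim: n => // n IHn; rewrite ltnS leq_eqVlt => /predU1P[-> //|ltsn].
  by rewrite aS // IHn.
have gP : multilinear (fun s => a (size s).+1 s).
  by move=> s t c x y; rewrite !size_cat /= multP.
exists (Mult gP); apply: mult_ext => s /=.
by apply: (PhiP (size s)) (leqnn _) => t /= ltts; rewrite aE.
Qed.

Lemma cst_multP (c : B) : multilinear (fun s : seq B => if s is [::] then c else 0).
Proof. by move=> [|z s] t k x y; rewrite /= scaler0 addr0. Qed.
Definition cst c : mult B := Mult (cst_multP c).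

Lemma cst_mul c f s : (cst c * f) s = c * f s.
Proof.
rewrite mult_mulE big_ord_recl take0 drop0 big1 ?addr0 // => k _.
by case: s k => [[]//|x s] k; rewrite /= mul0r.
Qed.

(** A right inverse g of f satisfies g = f_0^-1 (1 - (f - f_0) g), where the right side
uses g in lower arities only. Since that inverse lies in Ginv as well, it has
a right inverse in turn, and right inverses are two-sided. *)
Lemma Ginv_unitr f : Ginv f <-> f \is a GRing.unit.
Proof.
have rinv g : Ginv g -> exists2 h, Ginv h & g * h = 1.
  case=> y [yg gy]; pose G := g - cst (g [::]).
  have G0 : G [::] = 0 by apply: subrr.
  have [|h hP] := @contraction_fixpoint (fun h => cst y * (1 - G * h)).
    move=> n h1 h2 eqh s les; rewrite !cst_mul !mult_subE; congr (_ * (_ - _)).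
    rewrite !mult_mulE !big_ord_recl take0 G0 !mul0r; congr (_ + _).
    apply: eq_bigr => k _; rewrite eqh // size_drop.
    by rewrite (leq_trans _ les) // ltn_subrL (leq_ltn_trans _ (ltn_ord k)).
  have gh : g * h = 1.
    rewrite -[g](subrK (cst (g [::]))) -/G mulrDl -[X in cst _ * X]hP.
    apply: mult_ext => s; rewrite -[LHS]/((G * h) s + (cst (g [::]) * _) s).
    by rewrite !cst_mul mulrA gy mul1r mult_subE addrC subrK.
  exists h => //; have gh0 : g [::] * h [::] = 1.
    by rewrite -mult_mul_nil gh.
  exists (g [::]); split=> //.
  by rewrite -[h [::]]mul1r -yg -(mulrA y) gh0 mulr1 yg.
split=> [/rinv[g /rinv[h _ gh] fg]|fU]; last first.
  by exists (f^-1 [::]); rewrite -!mult_mul_nil mulVr ?mulrV.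
have hf : h = f by rewrite -[h]mul1r -fg -mulrA gh mulr1.
by apply/unitrP; exists g; rewrite -{1}hf.
Qed.

Lemma eq_comp_fun (f g h : seq B -> B) s :
  (forall t, size t <= size s -> g t = h t)%N -> comp_fun f g s = comp_fun f h s.
Proof.
have [n] := ubnP (size s); elim: n => // n IHn in f s *; rewrite ltnS.
case: s => [|x s] les gh; first by rewrite !comp_fun_nil.
rewrite !comp_fun_cons; apply: eq_bigr => k _.
rewrite gh ?IHn //= ?size_drop ?(leq_ltn_trans (leq_subr _ _)) // => [t let_|].
  by rewrite gh //= (leq_trans let_) // (leq_trans (leq_subr _ _)).
by rewrite ltnS size_takel ?leq_ord.
Qed.

Lemma comp_seq1 f g x : (f \oM g) [:: x] = f [:: g [:: x]].
Proof. by rewrite [LHS]comp_fun_cons big_ord1 comp_fun_nil. Qed.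

(** Splitting f as f_1 + F, where F starts in arity 2, the equation f o g = I becomes
g = f_1^-1 (I - F o g); a term of F o g has at least two blocks, hence uses g in
lower arities only. *)
Lemma Gdif_rinv f : Gdif f -> exists2 g, Gdif g & f \oM g = Id.
Proof.
case=> f0 [p pK Kp].
have fL c x y : f [:: c *: x + y] = c *: f [:: x] + f [:: y].
  exact: (multP f [::] [::]).
have pL c x y : p (c *: x + y) = c *: p x + p y.
  by apply: (can_inj pK); rewrite fL !Kp.
pose post q (qL : forall c x y, q (c *: x + y) = c *: q x + q y) h :=
  @Mult K B (q \o h) (fun s t c x y => etrans (congr1 q (multP h s t c x y)) (qL _ _ _)).
have pD : {morph p : x y / x + y} by move=> x y; rewrite -{1}[x]scale1r pL scale1r.
have fD : {morph (fun x => f [:: x]) : x y / x + y}.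
  by move=> x y; rewrite -{1}[x]scale1r fL scale1r.
(* f_1 as a series concentrated in arity 1. *)
pose f1 := post _ fL Id; pose F := f - f1.
have F0 : F [::] = 0.
  by rewrite -[LHS]/(f [::] - f [:: 0]) f0 (morphD0 fD) subrr.
have F1 x : F [:: x] = 0 by apply: subrr.
have fE : f = F + f1 by rewrite subrK.
clearbody F.
have [|g gP] := @contraction_fixpoint (fun g => post _ pL (Id - F \oM g)).
  move=> n g h gh [|x s] les; congr (p (_ - _)); rewrite ?comp_nil //.
  (* The last term, with all the variables in one block, vanishes by F1. *)
  rewrite ![(F \oM _) _]comp_fun_cons !big_ord_recr /=.
  rewrite drop_size !comp_fun_nil /= !F1; congr (_ + _).
  apply: eq_bigr => k _; rewrite gh; last first.
    by rewrite /= size_takel ?(ltnW (ltn_ord k)) // (leq_trans _ les) ?ltnS.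
  apply: eq_comp_fun => t let_; apply: gh; rewrite (leq_ltn_trans let_) // size_drop.
  by rewrite (leq_ltn_trans (leq_subr _ _)).
have g0 : g [::] = 0.
  rewrite -gP -[LHS]/(p (0 - (F \oM g) [::])).
  by rewrite comp_nil F0 subr0 (morphD0 pD).
have fg : f \oM g = Id.
  rewrite fE compD; apply: mult_ext => s.
  rewrite -[LHS]/((F \oM g) s + (f1 \oM g) s).
  rewrite [X in _ + X](comp_fun_additive _ _ _ fD) -[comp_fun _ _ s]/((Id \oM g) s).
  by rewrite compIl // -[in X in _ + X]gP [X in _ + X]Kp mult_subE addrC subrK.
have gE x : g [:: x] = p x by rewrite -[LHS]pK -comp_seq1 fg.
exists g => //; split=> //.
by exists (fun x => f [:: x]) => x; rewrite gE ?pK ?Kp.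
Qed.

Lemma comp_invP f : Gdif f ->
  [/\ Gdif (comp_inv f), comp_inv f \oM f = Id & f \oM comp_inv f = Id].
Proof.
move=> fG; have [g gG fg] := Gdif_rinv fG; have [h [h0 _] gh] := Gdif_rinv gG.
have hf : h = f by rewrite -(compIl h0) -fg -compA gh compIr.
rewrite /comp_inv; case: xgetP => [h' _ [? []] //|noinv].
by case: (noinv g); rewrite -{1}hf.
Qed.

Lemma comp_inv_unique f g : Gdif f -> g [::] = 0 -> f \oM g = Id -> comp_inv f = g.
Proof.
move=> fG g0 fg; have [_ VK _] := comp_invP fG.
by rewrite -[LHS]compIr -fg compA VK compIl.
Qed.

Lemma comp_eq_invr f g h : Gdif f -> (h = g \oM comp_inv f) <-> (h \oM f = g).
Proof.
move=> /comp_invP[_ fV Vf]; split=> [->|<-].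
  by rewrite -compA fV compIr.
by rewrite -compA Vf compIr.
Qed.

Lemma comp_unit f g : f \is a GRing.unit -> f \oM g \is a GRing.unit.
Proof.
move=> fU; apply/unitrP; exists (f^-1 \oM g).
by rewrite -!compM mulVr ?mulrV // comp1.
Qed.

Lemma compV f g : f \is a GRing.unit -> f^-1 \oM g = (f \oM g)^-1.
Proof.
move=> fU; apply: (mulrI (comp_unit g fU)).
by rewrite -compM !mulrV ?comp1 ?comp_unit.
Qed.

Lemma eq_comp_inv f g : g [::] = 0 -> Gdif f -> g = comp_inv f <-> f \oM g = Id.
Proof.
move=> g0 fG; split=> [->|fg]; last by rewrite (comp_inv_unique fG g0 fg).
by case: (comp_invP fG).
Qed.

(** * Products with the identity series *)

Lemma Id_mul_nil f : (Id * f) [::] = 0.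
Proof. by rewrite mult_mul_nil mul0r. Qed.

Lemma mul_Id_nil f : (f * Id) [::] = 0.
Proof. by rewrite mult_mul_nil mulr0. Qed.

Lemma Id_mul_cons f x s : (Id * f) (x :: s) = x * f s.
Proof.
rewrite mult_mulE 2!big_ord_recl /= mul0r add0r take0 drop0 big1 ?addr0 // => k _.
by case: s k => [[]//|y s] k; rewrite /= mul0r.
Qed.

Lemma mul_Id_rcons f x s : (f * Id) (rcons s x) = f s * x.
Proof.
rewrite mult_mulE size_rcons !big_ord_recr /= -cats1.
rewrite take_size_cat // drop_size_cat // [drop (size s).+1 _]drop_oversize;
  last by rewrite size_cat addn1.
rewrite mulr0 addr0 big1 ?add0r // => i _.
rewrite drop_cat ltn_ord; have: (0 < size (drop i s))%N by rewrite size_drop subn_gt0.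
by case: (drop i s) => // u [|v w] /= _; rewrite mulr0.
Qed.

Lemma Id_mulI : injective (fun f => Id * f).
Proof.
move=> f g /= fg; apply: mult_ext => s.
by rewrite -[LHS]mul1r -[RHS]mul1r -!Id_mul_cons fg.
Qed.

Lemma mul_IdI : injective (fun f => f * Id).
Proof.
move=> f g /= fg; apply: mult_ext => s.
by rewrite -[LHS]mulr1 -[RHS]mulr1 -!mul_Id_rcons fg.
Qed.

Lemma Gdif_Id_mul f : f \is a GRing.unit -> Gdif (Id * f).
Proof.
move=> /Ginv_unitr[y [yf fy]]; split; first exact: Id_mul_nil.
exists (fun x => x * y) => x; rewrite Id_mul_cons -mulrA ?fy ?yf mulr1 //.
Qed.

Lemma Gdif_mul_Id f : f \is a GRing.unit -> Gdif (f * Id).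
Proof.
move=> /Ginv_unitr[y [yf fy]]; split; first exact: mul_Id_nil.
exists (fun x => y * x) => x; rewrite (mul_Id_rcons f _ [::]) mulrA ?fy ?yf mul1r //.
Qed.

Lemma unitr_1D f : f [::] = 0 -> 1 + f \is a GRing.unit.
Proof.
move=> f0; apply/Ginv_unitr; exists 1.
by rewrite -[(1 + f) [::]]/(1 + f [::]) f0 addr0 mulr1.
Qed.

(** * Compositional inverses and S-transforms *)

(** The fixed-point form of the inverse is the one that interacts with I: it contains no
inverse, and I can be cancelled in it. *)
Lemma eq_comp_inv_mul_Id f g : f \is a GRing.unit -> g [::] = 0 ->
  g = comp_inv (f^-1 * Id) <-> g = (f \oM g) * Id.
Proof.
move=> fU g0; rewrite eq_comp_inv //; last by apply: Gdif_mul_Id; rewrite unitrV.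
rewrite compM compV // compIl //.
have fgU := comp_unit g fU.
by split=> [e|{2}->]; [rewrite -e mulVKr | rewrite mulKr].
Qed.

Lemma eq_comp_inv_Id_mul f g : f \is a GRing.unit -> g [::] = 0 ->
  g = comp_inv (Id * f^-1) <-> g = Id * (f \oM g).
Proof.
move=> fU g0; rewrite eq_comp_inv //; last by apply: Gdif_Id_mul; rewrite unitrV.
rewrite compM compV // compIl //.
have fgU := comp_unit g fU.
by split=> [e|{1}->]; [rewrite -e mulrVK | rewrite mulrK].
Qed.

Lemma eq_Sr_inv f g : f \is a GRing.unit ->
  g = Sr f^-1 <-> g * Id = comp_inv (f^-1 * Id).
Proof.
move=> fU; rewrite /Sr invrK; set V := comp_inv _.
have [[V0 _] _ _] : [/\ Gdif V, V \oM (f^-1 * Id) = Id & (f^-1 * Id) \oM V = Id].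
  by apply: comp_invP; apply: Gdif_mul_Id; rewrite unitrV.
have VE : V = (f \oM V) * Id by apply/(eq_comp_inv_mul_Id fU V0).
by split=> [->|] //; rewrite [in RHS]VE => /mul_IdI.
Qed.

Lemma eq_Sl_inv f g : f \is a GRing.unit ->
  g = Sl f^-1 <-> Id * g = comp_inv (Id * f^-1).
Proof.
move=> fU; rewrite /Sl invrK; set V := comp_inv _.
have [[V0 _] _ _] : [/\ Gdif V, V \oM (Id * f^-1) = Id & (Id * f^-1) \oM V = Id].
  by apply: comp_invP; apply: Gdif_Id_mul; rewrite unitrV.
have VE : V = Id * (f \oM V) by apply/(eq_comp_inv_Id_mul fU V0).
by split=> [->|] //; rewrite [in RHS]VE => /Id_mulI.
Qed.

Lemma Sl_unit f : f \is a GRing.unit -> Sl f \is a GRing.unit.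
Proof. by move=> fU; rewrite comp_unit ?unitrV. Qed.

Lemma Id_mul_Sl f : f \is a GRing.unit -> Id * Sl f = comp_inv (Id * f).
Proof. by move=> fU; rewrite -{2}[f]invrK; apply/eq_Sl_inv; rewrite ?unitrV ?invrK. Qed.

(** The compositional inverse of I zeta = I (1 - I)^-1 is I (1 + I)^-1, just as x / (1 + x)
inverts x / (1 - x). *)
Lemma Sl_zeta : Sl (zeta : mult B) = (1 + Id)^-1.
Proof.
have IU : 1 + Id \is a @GRing.unit (mult B) by apply: unitr_1D.
have zU : 1 - Id \is a @GRing.unit (mult B).
  by apply: unitr_1D; apply: oppr0.
apply/esym/eq_Sl_inv => //; apply/eq_comp_inv_Id_mul => //; first exact: Id_mul_nil.
rewrite compD comp1 compN compIl ?Id_mul_nil //; congr (_ * _).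
by apply: (mulIr IU); rewrite mulVr // mulrBl mul1r mulrVK // addrK.
Qed.

End Series.

(** * Moments, free cumulants and the boxed convolution *)

Section FreeCumulants.
Variables (K : fieldType) (B : algType K) (M C : mult B).
Let W := Id + Id * M * Id.

Let WIl : W = Id * (1 + M * Id). Proof. by rewrite mulrDr mulr1 mulrA. Qed.
Let WIr : W = (1 + Id * M) * Id. Proof. by rewrite mulrDl mul1r. Qed.
Let IMU : 1 + Id * M \is a GRing.unit. Proof. exact/unitr_1D/Id_mul_nil. Qed.
Let MIU : 1 + M * Id \is a GRing.unit. Proof. exact/unitr_1D/mul_Id_nil. Qed.
Let ICU : 1 + Id * C \is a GRing.unit. Proof. exact/unitr_1D/Id_mul_nil. Qed.
Let CIU : 1 + C * Id \is a GRing.unit. Proof. exact/unitr_1D/mul_Id_nil. Qed.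
Let W0 : W [::] = 0. Proof. by rewrite WIl Id_mul_nil. Qed.
Let WG : Gdif W. Proof. by rewrite WIl; apply: Gdif_Id_mul. Qed.
Let IdW : Id \oM W = W. Proof. exact: compIl. Qed.

(** The two common forms, free of inverses, to which the six relations between M and C
reduce. *)
Definition cumulant_left : Prop := (1 + M * Id) * (C \oM W) = M.
Definition cumulant_right : Prop := (C \oM W) * (1 + Id * M) = M.

Lemma cumulant_left_right : cumulant_left <-> cumulant_right.
Proof.
have comM : (1 + M * Id) * M = M * (1 + Id * M).
  by rewrite mulrDl mulrDr mul1r mulr1 mulrA.
split=> e; first by apply: (mulrI MIU); rewrite mulrA e comM.
by apply: (mulIr IMU); rewrite -mulrA e comM.
Qed.

Lemma cumulant_IdE :
  Id * C = (Id * M) \oM comp_inv W <-> cumulant_left.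
Proof.
rewrite comp_eq_invr // compM IdW {1}WIl -mulrA.
by split=> [/Id_mulI//|->].
Qed.

Lemma cumulant_EId :
  C * Id = (M * Id) \oM comp_inv W <-> cumulant_right.
Proof.
rewrite comp_eq_invr // compM IdW {2}WIr mulrA.
by split=> [/mul_IdI//|->].
Qed.

Lemma cumulant_eq_comp_inv_mul_Id :
  W = comp_inv ((1 + Id * C)^-1 * Id) <-> cumulant_left.
Proof.
rewrite eq_comp_inv_mul_Id // compD comp1 compM IdW [X in X = _]WIr.
rewrite {1}WIl -mulrA.
by split=> [/mul_IdI/addrI/Id_mulI|->].
Qed.

Lemma cumulant_eq_comp_inv_Id_mul :
  W = comp_inv (Id * (1 + C * Id)^-1) <-> cumulant_right.
Proof.
rewrite eq_comp_inv_Id_mul // compD comp1 compM IdW [X in X = _]WIl.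
rewrite {2}WIr mulrA.
by split=> [/Id_mulI/addrI/mul_IdI|->].
Qed.

Lemma cumulant_Sr : 1 + Id * M = Sr (1 + Id * C)^-1 <-> cumulant_left.
Proof. by rewrite eq_Sr_inv // -WIr cumulant_eq_comp_inv_mul_Id. Qed.

Lemma cumulant_Sl : 1 + M * Id = Sl (1 + C * Id)^-1 <-> cumulant_right.
Proof. by rewrite eq_Sl_inv // -WIl cumulant_eq_comp_inv_Id_mul. Qed.

(** With T the compositional inverse of I C, the point is that T o (I M) = W, which
makes I M the compositional inverse of I N for N = (1 + I)^-1 S^l(C). *)
Lemma cumulant_boxconv : C \is a GRing.unit -> cumulant_left -> M = C \boxconv zeta.
Proof.
move=> CU Cl; have Cr : cumulant_right by apply/cumulant_left_right.
have IU : 1 + Id \is a @GRing.unit (mult B) by apply: unitr_1D.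
rewrite /boxconv /bullet Sl_zeta invrK.
have -> : (1 + Id) * Id * (1 + Id)^-1 = Id :> mult B.
  by rewrite mulrDl mul1r -{1}[Id]mulr1 -mulrDr mulrK.
rewrite compIr; set N := _ * Sl C.
have NU : N \is a GRing.unit by rewrite unitrMl ?unitrV ?Sl_unit.
have [_ TV _] := comp_invP (Gdif_Id_mul CU).
set T := comp_inv _ in TV.
have IN : Id * N = (1 + Id)^-1 * T.
  rewrite /T -Id_mul_Sl // !mulrA; congr (_ * _).
  by apply: (mulrI IU); rewrite mulVKr // mulrA mulrDl mul1r -{1}[Id]mulr1 -mulrDr mulrK.
have TIM : T \oM (Id * M) = W.
  have -> : Id * M = (Id * C) \oM W by rewrite compM IdW {1}WIl -mulrA Cl.
  by rewrite compA TV.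
rewrite [RHS]/Sl; have -> : comp_inv (Id * N) = Id * M.
  apply: comp_inv_unique; [exact: Gdif_Id_mul | exact: Id_mul_nil |].
  by rewrite IN compM compV // compD comp1 compIl ?Id_mul_nil // TIM WIr mulKr.
rewrite /N invrM ?unitrV ?Sl_unit // invrK compM compD comp1 compIl ?Id_mul_nil //.
have -> : (Sl C)^-1 = C \oM T by rewrite /Sl compV // invrK.
by rewrite -compA TIM Cr.
Qed.

End FreeCumulants.

Theorem proposition3p28 (K : fieldType) (charK : [pchar K] =i pred0)
    (B : algType K) :
  (forall M C : mult B, Ginv M -> Ginv C ->
     [<-> Id * C = (Id * M) \oM comp_inv (Id + Id * M * Id);
          C * Id = (M * Id) \oM comp_inv (Id + Id * M * Id);
          Id + Id * M * Id = comp_inv ((1 + Id * C)^-1 * Id);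
          Id + Id * M * Id = comp_inv (Id * (1 + C * Id)^-1);
          1 + Id * M = Sr (1 + Id * C)^-1;
          1 + M * Id = Sl (1 + C * Id)^-1 ]
     /\ (Id * C = (Id * M) \oM comp_inv (Id + Id * M * Id) ->
         M = C \boxconv zeta))
  /\
  (forall (A : bprobSpace B) (a : A) (C : mult B),
     Ginv (moment a) -> Ginv C -> is_free_cumulant a C ->
     moment a = C \boxconv zeta).
Proof.
have box (M C : mult B) : Ginv C ->
    Id * C = (Id * M) \oM comp_inv (Id + Id * M * Id) -> M = C \boxconv zeta.
  by move=> /Ginv_unitr CU /cumulant_IdE; apply: cumulant_boxconv.
split=> [M C _ CG|A a C _ CG]; last exact: box.
split; last exact: box.
tfae.
- by move/cumulant_IdE/cumulant_left_right/cumulant_EId.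
- by move/cumulant_EId/cumulant_left_right/cumulant_eq_comp_inv_mul_Id.
- by move/cumulant_eq_comp_inv_mul_Id/cumulant_left_right/cumulant_eq_comp_inv_Id_mul.
- by move/cumulant_eq_comp_inv_Id_mul/cumulant_left_right/cumulant_Sr.
- by move/cumulant_Sr/cumulant_left_right/cumulant_Sl.
- by move/cumulant_Sl/cumulant_left_right/cumulant_IdE.
Qed.
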